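(* Let $k$ be a positive integer, let $a$ be a positive odd integer, and let $j$ be a positive integer such that $a$ reaches $1$ with $j$ iterations of the Collatz map $T$. Then $4^k a+\frac{4^k-1}{3}$ reaches $1$ with $2k+j$ iterations of $T$.
   Context: The Collatz map $T$ on the positive integers is $T(m)=m/2$ if $m$ is even and $T(m)=3m+1$ if $m$ is odd; $T^i$ denotes its $i$-fold iterate. A positive integer $m$ ''reaches $1$ with $j$ iterations'' if $j$ is the smallest positive integer with $T^j(m)=1$ (so, in particular, $1$ itself reaches $1$ with $3$ iterations). *)

(* Defs.v *)
From mathcomp Require Import all_boot.

Set Implicit Arguments.
Unset Strict Implicit.
Unset Printing Implicit Defensive.

(* The Collatz map is only meant on positive integers, which it preserves;
   the value at 0 (here 0) plays no role. *)
Definition collatz (m : nat) : nat :=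
  if odd m then 3 * m + 1 else m %/ 2.

(* [j] is the smallest positive number of iterations taking [m] to 1; since
   zero iterations are excluded, 1 itself reaches 1 with 3 iterations. *)
Definition reaches_one_with (m j : nat) : Prop :=
  [/\ 0 < j, iter j collatz m = 1
    & forall i, 0 < i -> iter i collatz m = 1 -> j <= i].

(* Main.v *)
Require Import Defs.
From mathcomp Require Import all_boot zify.

(** The numbers [b_k = 4 ^ k * a + (4 ^ k - 1) / 3] are the iterates of
    [m |-> 4 * m + 1] starting from [a], and all of them are odd.  For odd [m]
    the trajectory of [4 * m + 1] begins
    [4 * m + 1, 4 * (3 * m + 1), 2 * (3 * m + 1), 3 * m + 1], and the last of
    these is also the first iterate of [m]: the trajectory of [4 * m + 1]
    merges with that of [m] after a delay of exactly two steps
    ([iter_collatz_4m1]).  Since the values met before merging exceed 1, passing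
    from [m] to [4 * m + 1] raises the number of iterations needed by exactly
    two ([reaches_one_with_4m1]), and the result follows by induction on [k]. *)

Lemma collatz_odd m : odd m -> collatz m = 3 * m + 1.
Proof. by rewrite /collatz => ->. Qed.

Lemma collatz_double m : collatz (2 * m) = m.
Proof. by rewrite /collatz oddM /= mulKn. Qed.

Lemma collatz_4m1 m : collatz (4 * m + 1) = 2 * (2 * (3 * m + 1)).
Proof. by rewrite collatz_odd; lia. Qed.

Lemma iter_collatz_4m1 m i :
  odd m -> iter i.+3 collatz (4 * m + 1) = iter i.+1 collatz m.
Proof.
by move=> m_odd; rewrite !iterSr collatz_4m1 !collatz_double collatz_odd.
Qed.

Lemma reaches_one_with_4m1 m j :
  odd m -> reaches_one_with m j -> reaches_one_with (4 * m + 1) j.+2.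
Proof.
move=> m_odd [j_gt0 itj_m min_j]; split=> //.
  by case: j j_gt0 itj_m {min_j} => // j _; rewrite iter_collatz_4m1.
move=> [|[|[|i]]] // _.
(* The first two iterates are positive multiples of [3 * m + 1], so not 1. *)
- by rewrite /= collatz_4m1; lia.
- by rewrite /= collatz_4m1 collatz_double; lia.
by rewrite iter_collatz_4m1 // => /(min_j i.+1 isT).
Qed.

(** The quotient is a geometric sum, so the truncated subtraction and the
    division lose nothing; this makes [b_k] satisfy [b_(k+1) = 4 * b_k + 1]. *)
Lemma divn_4X_sub1S k : (4 ^ k.+1 - 1) %/ 3 = 4 * ((4 ^ k - 1) %/ 3) + 1.
Proof.
have expE n : 4 ^ n = 3 * ((4 ^ n - 1) %/ 3) + 1.
  elim: n => [//|n IHn]; rewrite expnS; lia.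
by have := expE k; rewrite expnS; lia.
Qed.

Theorem theorem2p4 (k a j : nat) (hk : 0 < k) (ha : 0 < a) (ha_odd : odd a)
    (hj : 0 < j) (haj : reaches_one_with a j) :
  reaches_one_with (4 ^ k * a + (4 ^ k - 1) %/ 3) (2 * k + j).
Proof.
(* The induction starts at [k = 0], where [b_0 = a], and carries oddness along,
   since the two-step delay is specific to odd numbers. *)
suff [] : odd (4 ^ k * a + (4 ^ k - 1) %/ 3) /\
          reaches_one_with (4 ^ k * a + (4 ^ k - 1) %/ 3) (2 * k + j) by [].
elim: k {hk} => [|k [b_odd b_reaches]]; first by rewrite mul1n addn0.
have -> : 4 ^ k.+1 * a + (4 ^ k.+1 - 1) %/ 3 =
          4 * (4 ^ k * a + (4 ^ k - 1) %/ 3) + 1.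
  by rewrite divn_4X_sub1S expnS mulnDr mulnA addnA.
split; first by rewrite oddD oddM.
by rewrite mulnS -addnA; apply: reaches_one_with_4m1.
Qed.
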